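(* Let $O=(a,b)\times(c,d)\subset\mathbb{R}^2$ and let $f\colon O\to\mathbb{R}$. Suppose that the partial derivative $\partial_1 f$ exists on $O$ and that it is partially strongly differentiable with respect to $y$ at $(x_0,y_0)$, with partial strong derivative denoted $\partial_2\partial_1 f(x_0,y_0)$. Let $A\subset O$ be the subset of those points where $\partial_2 f$ exists, and suppose that $(x_0,y_0)\in\bar A$. Then the function $\partial_2 f\colon A\to\mathbb{R}$ is partially strongly differentiable with respect to $x$ at $(x_0,y_0)$, and $\partial_1\partial_2 f(x_0,y_0)=\partial_2\partial_1 f(x_0,y_0)$; that is, the number $\partial_2\partial_1 f(x_0,y_0)$ is the partial strong derivative of $\partial_2 f|_A$ with respect to $x$ at $(x_0,y_0)$.
   Context: $\partial_1$ and $\partial_2$ denote the partial derivatives with respect to the first variable $x$ and the second variable $y$. A derivative is said to exist only if it exists as a finite real number. No continuity of $f$ is assumed. Partial strong differentiability: let $B\subset\mathbb{R}^2$, $g\colon B\to\mathbb{R}$ and $(x_0,y_0)\in\bar B$. The function $g$ is partially strongly differentiable with respect to $x$ at $(x_0,y_0)$, with partial strong derivative $L\in\mathbb{R}$ (denoted $\partial_1 g(x_0,y_0)$), if for every $\epsilon>0$ there is $\delta>0$ such that for all $x_1,x_2,y$ with $|x_1-x_0|<\delta$, $|x_2-x_0|<\delta$, $|y-y_0|<\delta$, $(x_1,y)\in B$, $(x_2,y)\in B$, one has $$|g(x_2,y)-g(x_1,y)-L(x_2-x_1)|\le\epsilon|x_2-x_1|.$$ Partial strong differentiability with respect to $y$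 (with partial strong derivative denoted $\partial_2 g(x_0,y_0)$) is defined in the same way with the roles of the two variables exchanged: for all $x,y_1,y_2$ within $\delta$ of $x_0,y_0,y_0$ respectively with $(x,y_1),(x,y_2)\in B$, $|g(x,y_2)-g(x,y_1)-L(y_2-y_1)|\le\epsilon|y_2-y_1|$. In the theorem the first notion is applied to $g=\partial_2 f|_A$ with $B=A$, and the second to $g=\partial_1 f$ with $B=O$. *)

(* Defs.v *)
From mathcomp Require Import all_boot all_order all_algebra.
From mathcomp Require Import all_classical all_reals all_analysis.

Set Implicit Arguments.
Unset Strict Implicit.
Unset Printing Implicit Defensive.

Import Order.TTheory GRing.Theory Num.Theory.
Import numFieldNormedType.Exports.

Local Open Scope classical_set_scope.
Local Open Scope ring_scope.

(* A function on a subset of the plane is represented by a total function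
   [R * R -> R] whose values off that subset are never used: on an open
   rectangle the derivatives below depend only on values inside it, and the
   partial derivatives [partial1], [partial2], which take junk values where the
   derivative does not exist, are only evaluated at points of the set [B] in
   the definitions of strong differentiability. *)

Section Partial.
Context {R : realType}.
Implicit Types (f g : R * R -> R) (B : set (R * R)) (p : R * R) (L : R).

Definition rectangle (a b c d : R) : set (R * R) := `]a, b[ `*` `]c, d[.

Definition partial1_exists f p : Prop :=
  derivable (fun x : R => f (x, p.2)) p.1 1.

Definition partial2_exists f p : Prop :=
  derivable (fun y : R => f (p.1, y)) p.2 1.

Definition partial1 f p : R := derive1 (fun x : R => f (x, p.2)) p.1.

Definition partial2 f p : R := derive1 (fun y : R => f (p.1, y)) p.2.

(* [L] need not be determined by [B], [g], [p]: this is a relation because [B]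
   may fail to contain two distinct points on a common line parallel to the
   axis near [p]. *)
Definition is_partial_strong_derivative1 B g p L : Prop :=
  closure B p /\
  forall eps : R, 0 < eps -> exists2 delta : R, 0 < delta &
    forall x1 x2 y : R,
      `|x1 - p.1| < delta -> `|x2 - p.1| < delta -> `|y - p.2| < delta ->
      B (x1, y) -> B (x2, y) ->
      `|g (x2, y) - g (x1, y) - L * (x2 - x1)| <= eps * `|x2 - x1|.

Definition is_partial_strong_derivative2 B g p L : Prop :=
  closure B p /\
  forall eps : R, 0 < eps -> exists2 delta : R, 0 < delta &
    forall x y1 y2 : R,
      `|x - p.1| < delta -> `|y1 - p.2| < delta -> `|y2 - p.2| < delta ->
      B (x, y1) -> B (x, y2) ->
      `|g (x, y2) - g (x, y1) - L * (y2 - y1)| <= eps * `|y2 - y1|.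

End Partial.

(* Main.v *)
(* The mean value theorem, applied to [x |-> f (x, y + h) - f (x, y) - L h x],
   bounds the second difference of [f] minus [L h (x2 - x1)] by
   [eps |h| |x2 - x1|]; dividing by [h] and letting [h] tend to [0] gives the
   claim at every pair of points where [partial2 f] exists. *)

Require Import Defs.
From mathcomp Require Import all_boot all_order all_algebra.
From mathcomp Require Import all_classical all_reals all_analysis.
From mathcomp Require Import ring lra.

Set Implicit Arguments.
Unset Strict Implicit.
Unset Printing Implicit Defensive.

Import Order.TTheory GRing.Theory Num.Theory.
Import numFieldNormedType.Exports.

Local Open Scope classical_set_scope.
Local Open Scope ring_scope.

Lemma mean_value_le (R : realType) (g dg : R -> R) (u v M : R) :
  u <= v ->
  (forall x, u <= x <= v -> is_derive x 1 g (dg x)) ->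
  (forall x, u <= x <= v -> `|dg x| <= M) ->
  `|g v - g u| <= M * `|v - u|.
Proof.
move=> uv dgP dgM.
have [x||x xuv ->] := @MVT_segment R g dg u v uv.
- by rewrite in_itv /= => /andP[ux xv]; apply: dgP; rewrite !ltW.
- apply: derivable_within_continuous => x; rewrite in_itv /= => xuv.
  by have [] := dgP x xuv.
- rewrite normrM ler_wpM2r//.
  by apply: dgM; move: xuv; rewrite in_itv.
Qed.

(** The derivative in [x] of the auxiliary function [g] is exactly the expression bounded in the
    last hypothesis, so [mean_value_le] applies with [M] equal to [eps * |z - y|]. *)
Lemma second_difference_le (R : realType) (f : R * R -> R) (u v y z L eps : R) :
  u <= v ->
  (forall x, u <= x <= v -> partial1_exists f (x, y)) ->
  (forall x, u <= x <= v -> partial1_exists f (x, z)) ->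
  (forall x, u <= x <= v ->
    `|partial1 f (x, z) - partial1 f (x, y) - L * (z - y)|
      <= eps * `|z - y|) ->
  `|(f (v, z) - f (v, y)) - (f (u, z) - f (u, y)) - L * (z - y) * (v - u)|
    <= eps * `|z - y| * `|v - u|.
Proof.
move=> uv fy fz le_eps.
pose g x := f (x, z) - f (x, y) - L * (z - y) * x.
rewrite (_ : _ - _ - _ = g v - g u); last by rewrite /g; ring.
apply: mean_value_le uv _ le_eps => x xuv.
have dz : is_derive x 1 (fun t => f (t, z)) (partial1 f (x, z)).
  by rewrite /partial1 derive1E; apply/derivableP/fz.
have dy : is_derive x 1 (fun t => f (t, y)) (partial1 f (x, y)).
  by rewrite /partial1 derive1E; apply/derivableP/fy.
have dl : is_derive x 1 (fun t : R => L * (z - y) * t) (L * (z - y)).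
  have -> : (fun t : R => L * (z - y) * t) = (L * (z - y)) \*: (@id R) by [].
  by apply: is_derive_eq; rewrite scaler1.
exact: is_deriveB.
Qed.

(** Derivability is phrased with the scalings [h^-1 *:] and [h *: 1]; on the real line they are
    products, a form that matches second differences. *)
Lemma partial2_cvg (R : realType) (f : R * R -> R) (x y : R) :
  partial2_exists f (x, y) ->
  h^-1 * (f (x, h + y) - f (x, y)) @[h --> 0^'] --> partial2 f (x, y).
Proof.
rewrite /partial2_exists /derivable /= => fxy.
suff -> : (fun h : R => h^-1 * (f (x, h + y) - f (x, y))) =
    fun h : R => h^-1 *: (f (x, h *: 1 + y) - f (x, y)).
  by rewrite /partial2 derive1E.
by apply/funext => h; rewrite /GRing.scale /= mulr1.
Qed.

(** [partial2] is assumed to exist only at the two endpoints, because points between them may lie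
    outside [A]; the segment joining them is controlled through [partial1] alone. *)
Lemma partial2_difference_le (R : realType) (f : R * R -> R)
    (u v y L eps : R) :
  u <= v ->
  (\forall z \near y, forall x, u <= x <= v -> partial1_exists f (x, z)) ->
  (\forall z \near y, forall x, u <= x <= v ->
    `|partial1 f (x, z) - partial1 f (x, y) - L * (z - y)|
      <= eps * `|z - y|) ->
  partial2_exists f (u, y) -> partial2_exists f (v, y) ->
  `|partial2 f (v, y) - partial2 f (u, y) - L * (v - u)| <= eps * `|v - u|.
Proof.
move=> uv f1 le_eps /partial2_cvg cu /partial2_cvg cv.
have shift (P : set R) : (\forall z \near y, P z) ->
    \forall h \near (0 : R)^', P (h + y).
  move=> nP; apply: nbhs_dnbhs.
  have : h + y @[h --> (0 : R)] --> y.
    rewrite -[X in _ --> X]add0r; apply: cvgD; [exact: cvg_id|exact: cvg_cst].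
  exact.
have fy := nbhs_singleton f1.
pose q x h : R := h^-1 * (f (x, h + y) - f (x, y)).
have cuv : `|q v h - q u h - L * (v - u)| @[h --> 0^'] -->
    `|partial2 f (v, y) - partial2 f (u, y) - L * (v - u)|.
  by apply: cvg_norm; apply: cvgB; [exact: cvgB|exact: cvg_cst].
(* A non-strict bound passes to the limit, so it suffices to prove it for the quotients at small
   nonzero [h]. *)
apply: (cvgr_to_le cuv); rewrite /q.
near=> h.
have h0 : h != 0 by near: h; exact: nbhs_dnbhs_neq.
have fz : forall x, u <= x <= v -> partial1_exists f (x, h + y).
  by near: h; exact: shift f1.
have := @second_difference_le R f u v y (h + y) L eps uv fy fz.
have lez : forall x, u <= x <= v ->
    `|partial1 f (x, h + y) - partial1 f (x, y) - L * (h + y - y)|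
      <= eps * `|h + y - y|.
  by near: h; exact: shift le_eps.
move=> /(_ lez); rewrite addrK => le_h.
(* Multiplying by [|h|] clears [h^-1] and turns the goal into the second difference bound [le_h]. *)
rewrite -(ler_pM2l (_ : 0 < `|h|)) ?normr_gt0//.
rewrite -normrM mulrA [`|h| * eps]mulrC.
apply: le_trans le_h; rewrite le_eqVlt; apply/orP; left; apply/eqP.
congr `|_|; field.
Unshelve. all: by end_near.
Qed.

Theorem theorem3 (R : realType) (a b c d : R) (f : R * R -> R)
    (x0 y0 L : R) (O := rectangle a b c d)
    (A := [set p | O p /\ partial2_exists f p]) :
  (forall p, O p -> partial1_exists f p) ->
  is_partial_strong_derivative2 O (partial1 f) (x0, y0) L ->
  closure A (x0, y0) ->
  is_partial_strong_derivative1 A (partial2 f) (x0, y0) L.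
Proof.
move=> f1 [_ strong] clA; split=> // eps /strong[delta delta0 le_eps].
(* The [delta] of the hypothesis on [partial1 f] serves unchanged. *)
exists delta => //= x1 x2 y.
(* Exchanging [x1] and [x2] only changes the sign inside the absolute value. *)
wlog x12 : x1 x2 / x1 <= x2.
  move=> H x1d x2d yd A1 A2; have [/H|/ltW/H] := leP x1 x2; first exact.
  move=> /(_ x2d x1d yd A2 A1); rewrite -normrN [`|x1 - _|]distrC.
  by congr (`|_| <= _); ring.
move=> x1d x2d yd [[]]/=; rewrite !in_itv /= => /andP[ax1 _] yI fx1.
move=> [[]]/=; rewrite in_itv /= => /andP[_ x2b] _ fx2.
have Oz z x : c < z < d -> x1 <= x <= x2 -> O (x, z).
  move=> zI /andP[x1x xx2]; split; rewrite /= in_itv //=.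
  by rewrite (lt_le_trans ax1) // (le_lt_trans xx2).
have zI : \forall z \near y, c < z < d.
  by have := @near_in_itvoo R c d y; rewrite in_itv /= => /(_ yI);
    apply: filterS => z; rewrite in_itv.
apply: partial2_difference_le => //.
  by near=> z => x xI; apply/f1/Oz => //; near: z.
near=> z => x xI.
(* The interval of radius [delta] around [x0] is convex, so it contains all of [[x1, x2]]. *)
have xd : `|x - x0| < delta.
  by move: xI x1d x2d => /andP[? ?]; rewrite !ltr_norml; lra.
apply: le_eps => //=; last 2 first.
- exact: Oz.
- by apply: Oz => //; near: z.
(* The strict bound [|y - y0| < delta] is an open condition, hence it persists for [z] near [y]. *)
near: z.
have : `|z - y0| @[z --> y] --> `|y - y0|.
  by apply: cvg_norm; apply: cvgB; [exact: cvg_id|exact: cvg_cst].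
by move=> /cvgr_lt; apply.
Unshelve. all: by end_near.
Qed.
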